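(* Let $G$ be a group. Let $Y$ be a $1$-acyclic cocompact $G$-complex whose $1$-skeleton is a fine and hyperbolic graph and such that the $G$-stabilizers of $1$-cells are finite. Then there is a constant $C\ge 0$ such that $FV_{Y,\mathbb{Z}}(k)\le Ck$ for every $k$. In particular, $FV_{Y,\mathbb{Q}}(k)\le Ck$ for every $k$.
   Context: All complexes are combinatorial cell complexes and all maps are combinatorial, in the sense of Bridson--Haefliger (Chapter I.8, Appendix): a combinatorial map is continuous and restricts to a homeomorphism from each open cell onto an open cell, and attaching maps of cells are combinatorial for a suitable cell structure on the sphere; in particular each $2$-cell is attached along a closed edge path. All group actions on complexes are by combinatorial maps; a $G$-complex is a complex with such an action of $G$, and it is cocompact if there are finitely many $G$-orbits of cells. A complex is $1$-acyclic if it is connected and its first homology group over $\mathbb{Z}$ is trivial. A graph is a $1$-dimensional combinatorial complex (loops and multiple edges allowed). A circuit is a simple closed combinatorial path. A graph $\Gamma$ is fine if for every edge $e$ and each integer $L>0$, the number of circuits of length at most $L$ which contain $e$ is finite. A hyperbolic graph is a graph that is Gromov hyperbolic for the path metric with edges of length $1$. Let $\mathbb{K}$ be $\mathbb{Z}$ or $\mathbb{Q}$. For a complex $X$, an orientation is fixed for each cell of positive dimension, so the cellular chain group $C_i(X,\mathbb{K})$ is the free $\mathbb{K}$-module on the $i$-cells; $\|\cdot\|_1$ is the $\ell_1$-norm in this basis, and $Z_1(X,\mathbb{Z})$ is the group of integral cellular $1$-cycles. For $\gamma\in Z_1(X,\mathbb{Z})$ set $\|\gamma\|_{\partial,\mathbb{K}}=\inf\{\|\mu\|_1:\mu\in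 C_2(X,\mathbb{K}),\ \partial\mu=\gamma\}$, with $\inf\emptyset=\infty$. The homological Dehn function of $X$ over $\mathbb{K}$ is $FV_{X,\mathbb{K}}(k)=\sup\{\|\gamma\|_{\partial,\mathbb{K}}:\gamma\in Z_1(X,\mathbb{Z}),\ \|\gamma\|_1\le k\}$ for $k\in\mathbb{N}$, with $\sup\emptyset=0$; infimum and supremum are taken in $[0,\infty]$. *)

(* Defs.v *)
From HB Require Import structures.
From mathcomp Require Import all_boot all_order all_algebra.
From mathcomp Require Import finmap.
From mathcomp Require Import boolp classical_sets functions cardinality.
From mathcomp Require Import reals constructive_ereal ereal.
(* The notations of monalg clash with those of the analysis library. *)
From mathcomp Require Export -(notations) monalg.

Set Implicit Arguments.
Unset Strict Implicit.
Unset Printing Implicit Defensive.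

Import Order.TTheory GRing.Theory Num.Theory.

Local Open Scope classical_set_scope.
Local Open Scope ring_scope.

(* An oriented cell is a pair [(c, b)], with [b = true] when the orientation
   is opposite to the one fixed for [c]. *)
Section EdgePaths.
Variables (V E : choiceType) (ends : E -> V * V).

Definition orev (T : Type) (x : T * bool) : T * bool := (x.1, ~~ x.2).

Definition osrc (x : E * bool) : V := if x.2 then (ends x.1).2 else (ends x.1).1.
Definition otgt (x : E * bool) : V := osrc (orev x).

Fixpoint edge_path (u : V) (p : seq (E * bool)) (v : V) : bool :=
  if p is x :: p' then (osrc x == u) && edge_path (otgt x) p' v else u == v.

Definition closed_path (p : seq (E * bool)) : bool :=
  if p is x :: _ then edge_path (osrc x) p (osrc x) else false.

Definition path_inv (p : seq (E * bool)) : seq (E * bool) :=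
  rev (map (@orev E) p).

(* The second condition excludes the backtracking path [:: x; orev x]. *)
Definition circuit (p : seq (E * bool)) : bool :=
  [&& closed_path p, uniq (map osrc p) & uniq (map fst p)].

End EdgePaths.

(* A combinatorial cell complex of arbitrary dimension. [ends e] is the pair
   (initial vertex, terminal vertex) of the 1-cell [e] for its fixed
   orientation; a 2-cell is attached along the nonempty closed edge path
   [bdry f], read from some vertex in the direction given by the fixed
   orientation of [f]. The attaching maps of cells of dimension at least 3 are
   not recorded: connectedness, H_1, the 1-skeleton and FV do not involve
   them. *)
Record cell_complex := CellComplex {
  cell : nat -> choiceType;
  ends : cell 1 -> cell 0 * cell 0;
  bdry : cell 2 -> seq (cell 1 * bool);
  bdry_closed : forall f, closed_path ends (bdry f)
}.

Definition obdry (Y : cell_complex) (y : cell Y 2 * bool) :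
    seq (cell Y 1 * bool) :=
  if y.2 then path_inv (bdry y.1) else bdry y.1.

(* The map induced on oriented cells by a map [f] of cells that changes the
   fixed orientation of [c] exactly when [s c]. *)
Definition omap (T : Type) (f : T -> T) (s : T -> bool) (x : T * bool) :
    T * bool := (f x.1, s x.1 (+) x.2).

(* A left action by combinatorial maps. Up to isotopy, the homeomorphism from a
   2-cell to its image under [g] is an isomorphism of the boundary polygons: it
   is given by its effect on orientations ([flip]) and by the index [twist g y]
   of the side of [y] that is sent to the first side of the image of [y]. The
   conditions on [twist] say that these polygon isomorphisms compose as in [G]
   and do not depend on the direction in which polygons are read. *)
Record cell_action (G : groupType) (Y : cell_complex) := CellAction {
  act : forall n, G -> cell Y n -> cell Y n;
  flip : forall n, G -> cell Y n.+1 -> bool;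
  twist : G -> cell Y 2 * bool -> nat;
  act_id : forall n (c : cell Y n), act 1%g c = c;
  act_mul : forall n g h (c : cell Y n), act (g * h)%g c = act g (act h c);
  flip_mul : forall n g h (c : cell Y n.+1),
    flip (g * h)%g c = flip g (act h c) (+) flip h c;
  osrc_act : forall g (x : cell Y 1 * bool),
    osrc (@ends Y) (omap (act g) (flip g) x) = act g (osrc (@ends Y) x);
  obdry_act : forall g (y : cell Y 2 * bool),
    obdry (omap (act g) (flip g) y) =
    rot (twist g y) (map (omap (act g) (flip g)) (obdry y));
  twist_lt : forall g (y : cell Y 2 * bool), (twist g y < size (obdry y))%N;
  twist_mul : forall g h (y : cell Y 2 * bool),
    (twist (g * h)%g y =
     twist g (omap (act h) (flip h) y) + twist h y %[mod size (obdry y)])%N;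
  twist_rev : forall g (y : cell Y 2 * bool),
    (twist g y + twist g (orev y) = 0 %[mod size (obdry y)])%N
}.

Section Action.
Variables (G : groupType) (Y : cell_complex) (A : cell_action G Y).

Definition orbit_cell (c : {n & cell Y n}) : set {n & cell Y n} :=
  [set Tagged (fun n => cell Y n) (act A g (tagged c)) | g in [set: G]].

Definition cocompact : Prop := finite_set (range orbit_cell).

Definition stabilizer n (c : cell Y n) : set G := [set g | act A g c = c].

Definition finite_edge_stabilizers : Prop :=
  forall e : cell Y 1, finite_set (stabilizer e).

End Action.

(* Loops and multiple edges being allowed, circuits are sequences of oriented
   edges. A circuit of length n is counted once for each of its 2n
   parametrizations, which does not affect finiteness. *)
Definition fine_skeleton (Y : cell_complex) : Prop :=
  forall (e : cell Y 1) (L : nat), (0 < L)%N ->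
    finite_set [set p : seq (cell Y 1 * bool) |
      circuit (@ends Y) p /\ (size p <= L)%N /\ e \in map fst p].

Section MetricGraph.
Variables (R : realType) (Y : cell_complex).

(* Points of the 1-skeleton, with edges of length 1: [OnEdge e t] is the point
   at distance [t] from the initial vertex along [e]. End points of edges are
   represented several times, at mutual distance 0. *)
Inductive gpoint : Type :=
| AtVertex of cell Y 0
| OnEdge (e : cell Y 1) (t : R) of 0 <= t <= 1.

Definition exits (p : gpoint) : seq (cell Y 0 * R) :=
  match p with
  | AtVertex v => [:: (v, 0)]
  | OnEdge e t _ => [:: ((ends e).1, t); ((ends e).2, 1 - t)]
  end.

(* [route p q l]: some path of length [l] joins [p] to [q], either inside an
   edge or through vertices. *)
Variant route : gpoint -> gpoint -> R -> Prop :=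
| RouteInEdge e s t hs ht :
    route (@OnEdge e s hs) (@OnEdge e t ht) `|s - t|
| RouteVia p q v a c w b :
    (v, a) \in exits p -> (w, b) \in exits q -> edge_path (@ends Y) v c w ->
    route p q (a + (size c)%:R + b).

Definition gdist (p q : gpoint) : R := inf [set l | route p q l].

Definition gromov_product (w p q : gpoint) : R :=
  (gdist p w + gdist q w - gdist p q) / 2.

Definition hyperbolic_skeleton : Prop :=
  exists delta : R, forall w p q r : gpoint,
    Num.min (gromov_product w p q) (gromov_product w q r) - delta
      <= gromov_product w p r.

End MetricGraph.

Local Notation "c @_ x" := (mcoeff x c)
  (at level 3, x at level 2, left associativity).
Local Notation "<< a *g x >>" := (mkmalgU x a).
Local Notation "<< x >>" := << 1 *g x >>.

Section Chains.
Variables (Y : cell_complex) (K : nzRingType).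

Definition chain (n : nat) : Type := malg (cell Y n) K.

Definition path_chain (p : seq (cell Y 1 * bool)) : chain 1 :=
  \sum_(x <- p) << (-1) ^+ x.2 *g x.1 >>.

Definition d1 (c : chain 1) : chain 0 :=
  \sum_(e <- msupp c) c@_e *: (<< (ends e).2 >> - << (ends e).1 >>).

Definition d2 (c : chain 2) : chain 1 :=
  \sum_(f <- msupp c) c@_f *: path_chain (bdry f).

Definition l1norm (R : realType) (iota : K -> R) n (c : chain n) : R :=
  \sum_(x <- msupp c) `|iota c@_x|.

End Chains.

Definition one_acyclic (Y : cell_complex) : Prop :=
  (forall u v : cell Y 0, exists p, edge_path (@ends Y) u p v) /\
  (forall c : chain Y int 1, d1 c = 0 -> exists mu : chain Y int 2, d2 mu = c).

Section DehnFunction.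
(* [iota] is the inclusion of the coefficient ring in the real numbers. *)
Variables (R : realType) (K : nzRingType) (iota : K -> R) (Y : cell_complex).

Definition filling_norm (c : chain Y int 1) : \bar R :=
  ereal_inf [set (l1norm iota mu)%:E | mu in
    [set mu : chain Y K 2 | forall e, (d2 mu)@_e = (c@_e)%:~R]].

(* The supremum is over a set that contains the filling norm of 0. *)
Definition FV (k : nat) : \bar R :=
  ereal_sup [set filling_norm c | c in
    [set c : chain Y int 1 | d1 c = 0 /\
       l1norm (intr : int -> R) c <= k%:R]].

End DehnFunction.

Definition FV_Z (R : realType) (Y : cell_complex) : nat -> \bar R :=
  FV (intr : int -> R) Y.
Definition FV_Q (R : realType) (Y : cell_complex) : nat -> \bar R :=
  FV (ratr : rat -> R) Y.

(* Main.v *)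
Require Import Defs.
From mathcomp Require Import all_boot all_order all_algebra.
From mathcomp Require Import finmap.
From mathcomp Require Import boolp classical_sets cardinality.
From mathcomp Require Import reals constructive_ereal ereal.
From mathcomp Require Import zify lra.

(** In a hyperbolic graph a closed path longer than some constant D cannot be
    a local geodesic at scale 2(D + 1): by the four-point inequality the
    distance from its starting point would never come back down to zero. So it
    contains a short non-geodesic subpath, and exchanging that subpath for a
    geodesic makes the closed path shorter at the cost of one closed path of
    length at most N = 4(D + 1) ([shortcut]). By iteration, a closed path of
    length n is, as a 1-chain, a sum of at most n closed paths of length at
    most N ([filled_of_short]): this is the linear isoperimetric inequality of
    hyperbolic graphs.

    A closed path of length at most N is a sum of at most N circuits of length
    at most N ([filled_of_circuits]). Each circuit bounds an integral 2-chain
    because the first homology vanishes. By fineness, finitely many circuits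
    of length at most N pass through a given edge, and by cocompactness there
    are finitely many orbits of edges; as fillings can be translated by the
    group, one bound on the size of fillings is good for all circuits of
    length at most N ([circuits_uniformly_filled]).

    Finally an integral 1-cycle of norm k is a sum of closed paths of total
    length k ([cycle_filled]), so it has an integral filling of norm at most a
    constant times k. An integral filling is also a rational one, which gives
    both bounds at once ([FV_le]).

    Integral chains are handled as lists of oriented cells: the length of a
    list bounds the norm of its chain, concatenation adds chains, and the group
    acts on lists letter by letter. *)

Set Implicit Arguments.
Unset Strict Implicit.
Unset Printing Implicit Defensive.

Import Order.TTheory GRing.Theory Num.Theory.

Local Open Scope ring_scope.

Local Notation "c @_ x" := (mcoeff x c)
  (at level 3, x at level 2, left associativity).
Local Notation "<< a *g x >>" := (mkmalgU x a).
Local Notation "<< x >>" := << 1 *g x >>.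

(** * Edge paths and distance in a graph *)

Section Paths.
Variables (V E : choiceType) (ends : E -> V * V).
Implicit Types (u v w : V) (x : E * bool) (p q : seq (E * bool)).

Lemma orevK : involutive (@orev E).
Proof. by case=> e b; rewrite /orev /= negbK. Qed.

Definition walk_end u p : V := last u (map (otgt ends) p).

Lemma edge_path_end u p v : edge_path ends u p v -> walk_end u p = v.
Proof. by elim: p u => [|x p IH] u /=; [move/eqP|case/andP=> _ /IH]. Qed.

Lemma edge_path_catE u p q v : edge_path ends u (p ++ q) v =
  edge_path ends u p (walk_end u p) && edge_path ends (walk_end u p) q v.
Proof.
elim: p u => [|x p IH] u /=; first by rewrite eqxx.
by rewrite IH andbA.
Qed.

Lemma edge_path_cat u v w p q : edge_path ends u p v ->
  edge_path ends v q w -> edge_path ends u (p ++ q) w.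
Proof. by move=> pP qP; rewrite edge_path_catE (edge_path_end pP) pP. Qed.

Lemma edge_path_split u p q v : edge_path ends u (p ++ q) v ->
  exists2 w, edge_path ends u p w & edge_path ends w q v.
Proof. by rewrite edge_path_catE => /andP[]; exists (walk_end u p). Qed.

Lemma edge_path_inv u p v :
  edge_path ends u p v -> edge_path ends v (path_inv p) u.
Proof.
elim: p u => [|x p IH] u /=; first by rewrite eq_sym.
case/andP=> /eqP xu /IH pP; rewrite /path_inv /= rev_cons -cats1.
apply: edge_path_cat pP _ => /=.
by rewrite /otgt orevK xu !eqxx.
Qed.

Lemma closed_pathP p :
  reflect (p <> [::] /\ exists u, edge_path ends u p u) (closed_path ends p).
Proof.
case: p => [|x p]; first by constructor; case.
apply: (iffP idP) => [H|[_ [u /= /andP[/eqP<- H]]]].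
  by split=> //; exists (osrc ends x).
by rewrite /closed_path /= eqxx.
Qed.

Definition is_distance (d : V -> V -> nat) : Prop := forall u v,
  (exists2 p, edge_path ends u p v & size p = d u v) /\
  (forall p, edge_path ends u p v -> (d u v <= size p)%N).

Lemma exists_distance :
  (forall u v, exists p, edge_path ends u p v) -> exists d, is_distance d.
Proof.
move=> conn.
suff /choice[d dP] : forall uv : V * V, exists n : nat,
    (exists2 p, edge_path ends uv.1 p uv.2 & size p = n) /\
    (forall p, edge_path ends uv.1 p uv.2 -> (n <= size p)%N).
  by exists (fun u v => d (u, v)) => u v; apply: dP (u, v).
case=> u v /=.
have [|n /asboolP nP nmin] :=
  @ex_minnP (fun n => `[< exists2 p, edge_path ends u p v & size p = n >]).
  by have [p pP] := conn u v; exists (size p); apply/asboolP; exists p.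
exists n; split=> // p pP; apply: nmin; apply/asboolP; by exists p.
Qed.

(** The four-point form of hyperbolicity, with the defect [D] on the distance
    itself rather than on Gromov products. *)
Definition four_point (d : V -> V -> nat) (D : nat) : Prop :=
  forall u a b c : V,
  (d a c + d u b <= maxn (d u a + d b c) (d u c + d a b) + D)%N.

Section Distance.
Variables (d : V -> V -> nat) (D : nat).
Hypotheses (dP : is_distance d) (d4 : four_point d D).

Lemma distance_sym u v : d u v = d v u.
Proof.
have le_d a b : (d a b <= d b a)%N.
  have [[p pP <-] _] := dP b a; have [_] := dP a b.
  by move=> /(_ _ (edge_path_inv pP)); rewrite size_rev size_map.
by apply/eqP; rewrite eqn_leq !le_d.
Qed.

(** Put L = D + 1. If all subpaths of length at most 2L were geodesic, the
    four-point inequality for the starting point and three successive multiples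
    of L would show, by induction, that the distance from the starting point to
    the points of index L, 2L, 3L and so on never decreases, hence stays at
    least L. This contradicts that the last of these points is less than L
    steps away from the end of the path, which is its starting point. *)
Lemma shortcut u p : edge_path ends u p u -> (D < size p)%N ->
  exists a s b, p = a ++ s ++ b /\ (size s <= 2 * D.+1)%N /\
    exists2 s', (size s' < size s)%N &
    exists v w, [/\ edge_path ends u a v, edge_path ends v s w,
      edge_path ends v s' w & edge_path ends w b u].
Proof.
move=> pP Dp; pose L := D.+1; have LE : L = D.+1 by [].
pose z i := walk_end u (take i p).
have sub i l : (i + l <= size p)%N -> exists a s b,
    [/\ p = a ++ s ++ b, size s = l, edge_path ends u a (z i),
    edge_path ends (z i) s (z (i + l)%N) & edge_path ends (z (i + l)%N) b u].
  move=> ilp; exists (take i p), (take l (drop i p)), (drop (i + l) p).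
  have e1 : take i p ++ take l (drop i p) = take (i + l) p by rewrite takeD.
  have := pP; rewrite -{1}(cat_take_drop (i + l) p) edge_path_catE -/(z _).
  case/andP; rewrite -e1 edge_path_catE -/(z i) => /andP[aP sP] bP.
  rewrite catA e1 cat_take_drop; split=> //.
  by rewrite size_take size_drop; case: ltnP; lia.
(* Either every subpath of length at most 2L is geodesic, or one of those that
   are not provides the conclusion. *)
have [lg|] := pselect (forall i l, (i + l <= size p)%N -> (l <= 2 * L)%N ->
    d (z i) (z (i + l)%N) = l); last first.
  move=> /existsNP[i /existsNP[l /not_implyP[ilp /not_implyP[lL nd]]]].
  have [a [s [b [pE sl aP sP bP]]]] := sub i l ilp.
  exists a, s, b; rewrite sl; do 2!split=> //.
  have [[s' s'P s'd] /(_ _ sP)] := dP (z i) (z (i + l)%N).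
  rewrite sl => dl; exists s'; last by exists (z i), (z (i + l)%N).
  by rewrite s'd ltn_neqAle dl andbT; apply/eqP.
have dz i l : (i + l <= size p)%N -> (d (z i) (z (i + l)%N) <= l)%N.
  move=> H; have [a [s [b [_ <- _ sP _]]]] := sub i l H.
  by case: (dP (z i) (z (i + size s)%N)) => _; apply.
have far j : (j.+1 * L <= size p)%N -> (L <= d (z 0) (z (j.+1 * L)%N))%N /\
    (d (z 0) (z (j * L)%N) <= d (z 0) (z (j.+1 * L)%N))%N.
  elim: j => [|j IH] H.
    rewrite mul1n in H; rewrite mul0n mul1n.
    have d0L : d (z 0) (z L) = L by have := lg 0%N L; rewrite add0n; apply; lia.
    by rewrite d0L; have := dz 0%N 0%N (leq0n _); rewrite addn0; lia.
  have [|h1 h2] := IH; first by lia.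
  have e1 : (j.+1 * L = j * L + L)%N by lia.
  have e2 : (j.+2 * L = j * L + 2 * L)%N by lia.
  have e3 : (j.+2 * L = j.+1 * L + L)%N by lia.
  have := d4 (z 0) (z (j * L)%N) (z (j.+1 * L)%N) (z (j.+2 * L)%N).
  have -> : d (z (j * L)%N) (z (j.+2 * L)%N) = (2 * L)%N.
    by rewrite e2 lg //; lia.
  have -> : d (z (j * L)%N) (z (j.+1 * L)%N) = L by rewrite e1 lg //; lia.
  have -> : d (z (j.+1 * L)%N) (z (j.+2 * L)%N) = L by rewrite e3 lg //; lia.
  clear -h1 h2 LE; move: (d _ _) (d _ _) (d _ _) h1 h2 => b a c; lia.
(* The path ends less than L steps after its point of index j * L. *)
exfalso; pose j := (size p %/ L)%N; have j_gt0 : (0 < j)%N by rewrite divn_gt0.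
have pdiv := divn_eq (size p) L.
have ltL : (size p %% L < L)%N by rewrite ltn_mod.
have jp : (j.-1.+1 * L <= size p)%N by rewrite prednK // pdiv leq_addr.
have [+ _] := far _ jp; rewrite prednK //.
have zE : z (size p) = z 0%N.
  by rewrite /z take_size take0 (edge_path_end pP).
have := dz (j * L)%N (size p %% L)%N.
rewrite -pdiv zE distance_sym => /(_ (leqnn _)); lia.
Qed.

End Distance.
End Paths.

(** * Chains as lists of oriented cells *)

Section OrientedChains.
Variables (K : nzRingType) (X : choiceType).
Implicit Types (c : malg X K) (q : seq (X * bool)).

Definition ochain q : malg X K := \sum_(y <- q) << (-1) ^+ y.2 *g y.1 >>.

Lemma ochain_cat q q' : ochain (q ++ q') = ochain q + ochain q'.
Proof. by rewrite /ochain big_cat. Qed.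

Lemma ochain_cons y q : ochain (y :: q) = << (-1) ^+ y.2 *g y.1 >> + ochain q.
Proof. by rewrite /ochain big_cons. Qed.

Lemma ochain_perm q q' : perm_eq q q' -> ochain q = ochain q'.
Proof. exact: perm_big. Qed.

Lemma ochain_orev q : ochain (map (@orev X) q) = - ochain q.
Proof.
rewrite /ochain big_map -sumrN; apply: eq_bigr => -[x b] _ /=.
by rewrite -monalgUN; case: b; rewrite //= expr0 expr1 opprK.
Qed.

Lemma mcoeff_ochain q x :
  (ochain q)@_x = \sum_(y <- q) (-1) ^+ y.2 *+ (y.1 == x).
Proof.
elim: q => [|y q IH]; first by rewrite /ochain !big_nil mcoeff0.
by rewrite ochain_cons big_cons mcoeffD mcoeffU IH.
Qed.

Section Linear.
Variables (M : lmodType K) (F : X -> M).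

(** Both boundary maps are of this form. *)
Definition linear_ext c : M := \sum_(x <- msupp c) c@_x *: F x.

Lemma linear_extEw (D : {fset X}) c : (msupp c `<=` D)%fset ->
  linear_ext c = \sum_(x <- D) c@_x *: F x.
Proof.
move=> cD; apply: big_fset_incl => // x _ /mcoeff_outdom ->.
by rewrite scale0r.
Qed.

Lemma linear_extD c c' : linear_ext (c + c') = linear_ext c + linear_ext c'.
Proof.
pose D := (msupp c `|` msupp c')%fset.
rewrite (@linear_extEw D) ?msuppD_le // (@linear_extEw D c) ?fsubsetUl //.
rewrite (@linear_extEw D c') ?fsubsetUr // -big_split; apply: eq_bigr => x _ /=.
by rewrite mcoeffD scalerDl.
Qed.

Lemma linear_extU a x : linear_ext << a *g x >> = a *: F x.
Proof.
by rewrite (@linear_extEw [fset x]%fset) ?msuppU_le // big_seq_fset1 mcoeffUU.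
Qed.

Lemma linear_ext_ochain q :
  linear_ext (ochain q) = \sum_(y <- q) (-1) ^+ y.2 *: F y.1.
Proof.
elim: q => [|y q IH].
  by rewrite /ochain !big_nil /linear_ext msupp0 big_seq_fset0.
by rewrite ochain_cons big_cons linear_extD linear_extU IH.
Qed.

End Linear.
End OrientedChains.

Lemma mcoeff_ochain_int (K : nzRingType) (X : choiceType) (q : seq (X * bool))
    (x : X) :
  (ochain K q)@_x = ((ochain int q)@_x)%:~R.
Proof.
rewrite !mcoeff_ochain rmorph_sum; apply: eq_bigr => y _ /=.
by rewrite rmorphMn rmorph_sign.
Qed.

Lemma l1norm_ochain (R : realType) (Y : cell_complex) (n : nat)
    (K : nzRingType) (iota : {rmorphism K -> R}) (q : seq (cell Y n * bool)) :
  l1norm iota (ochain K q : chain Y K n) <= (size q)%:R.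
Proof.
pose norm (c : chain Y K n) : R := l1norm iota c.
have normEw (D : {fset cell Y n}) (c : chain Y K n) : (msupp c `<=` D)%fset ->
    norm c = \sum_(x <- D) `|iota c@_x|.
  move=> cD; apply: big_fset_incl => // x _ /mcoeff_outdom ->.
  by rewrite rmorph0 normr0.
have normD (c c' : malg (cell Y n) K) : norm (c + c') <= norm c + norm c'.
  pose D := (msupp c `|` msupp c')%fset.
  rewrite (normEw D) ?msuppD_le // (normEw D c) ?fsubsetUl //.
  rewrite (normEw D c') ?fsubsetUr // -big_split; apply: ler_sum => x _ /=.
  by rewrite mcoeffD rmorphD ler_normD.
rewrite -/(norm _); elim: q => [|y q IH].
  by rewrite /ochain big_nil /norm /l1norm msupp0 big_seq_fset0.
rewrite ochain_cons (le_trans (normD _ _)) // -natr1 addrC lerD //.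
rewrite (normEw [fset y.1]%fset) ?msuppU_le // big_seq_fset1 mcoeffUU.
by rewrite rmorphXn rmorphN rmorph1 normrX normrN normr1 expr1n.
Qed.

Lemma int_chain_ochain (X : choiceType) (c : malg X int) :
  exists2 q : seq (X * bool), ochain int q = c &
    size q = (\sum_(x <- msupp c) `|c@_x|)%N.
Proof.
exists (flatten [seq nseq `|c@_x|%N (x, c@_x < 0) | x <- msupp c]).
  rewrite [RHS]monalgE /ochain big_flatten big_map; apply: eq_bigr => x _.
  rewrite big_nseq /= iter_addr_0 -monalgUMn; congr (<< _ *g _ >>).
  by rewrite -mulr_natr natz -intEsign.
rewrite size_flatten /shape -map_comp sumnE big_map.
by apply: eq_bigr => x _; rewrite /= size_nseq.
Qed.

(** * Fillings by lists of oriented 2-cells *)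

Lemma not_uniq_map (T S : eqType) (f : T -> S) (p : seq T) :
  ~~ uniq (map f p) ->
  exists a x b y c, p = a ++ x :: b ++ y :: c /\ f x = f y.
Proof.
elim: p => //= x p IH; rewrite negb_and negbK.
case/orP=> [/mapP[y /splitPr[b c] xy]|].
  by exists [::], x, b, y, c.
by case/IH=> a [z [b [y [c [-> zy]]]]]; exists (x :: a), z, b, y, c.
Qed.

Section Fillings.
Variables (Y : cell_complex).
Implicit Types (p s : seq (cell Y 1 * bool)) (c : chain Y int 1).

Lemma path_chain_inv K p : path_chain K (path_inv p) = - path_chain K p.
Proof.
rewrite -[RHS]ochain_orev; apply: ochain_perm.
by rewrite /path_inv perm_rev.
Qed.

Lemma d2_ochain K (q : seq (cell Y 2 * bool)) :
  d2 (ochain K q) = path_chain K (flatten (map (@obdry Y) q)).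
Proof.
rewrite /d2 [LHS]linear_ext_ochain /path_chain big_flatten big_map.
apply: eq_bigr => -[f b] _; rewrite -/(path_chain K (obdry (f, b))) /obdry /=.
by case: b; rewrite ?expr0 ?scale1r // expr1 scaleN1r path_chain_inv.
Qed.

Lemma d1_path_chain K p : d1 (path_chain K p) =
  \sum_(x <- p) (<< otgt (@ends Y) x >> - << osrc (@ends Y) x >>).
Proof.
rewrite /d1 [LHS]linear_ext_ochain; apply: eq_bigr => -[e b] _.
by case: b; rewrite /otgt /osrc /= ?expr0 ?scale1r // expr1 scaleN1r opprB.
Qed.

Lemma d1_closed K u p : edge_path (@ends Y) u p u -> d1 (path_chain K p) = 0.
Proof.
rewrite d1_path_chain => pP; suff H v : edge_path (@ends Y) v p u ->
    \sum_(x <- p) (<< otgt (@ends Y) x >> - << osrc (@ends Y) x >>) =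
    << u >> - << v >> :> malg _ K by rewrite (H u) // subrr.
elim: p {pP} v => [|x p IH] v /=.
  by move/eqP->; rewrite big_nil subrr.
by case/andP=> /eqP<- /IH H; rewrite big_cons H addrC addrA subrK.
Qed.

(** Boundaries are compared as chains, so that a filling may be transported by
    any operation on lists of cells that respects chains. *)
Definition filled (m : nat) c : Prop := exists2 q : seq (cell Y 2 * bool),
  (size q <= m)%N & path_chain int (flatten (map (@obdry Y) q)) = c.

Lemma filled0 m : filled m 0.
Proof. by exists [::]; rewrite //= /path_chain big_nil. Qed.

Lemma filled_leq m n c : (m <= n)%N -> filled m c -> filled n c.
Proof. by move=> mn [q qm qc]; exists q => //; apply: leq_trans mn. Qed.

Lemma filledD m n c c' : filled m c -> filled n c' -> filled (m + n) (c + c').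
Proof.
move=> [q qm <-] [q' qn <-]; exists (q ++ q').
  by rewrite size_cat leq_add.
by rewrite map_cat flatten_cat; apply: ochain_cat.
Qed.

Lemma closed_path_filled u p : one_acyclic Y -> edge_path (@ends Y) u p u ->
  exists m, filled m (path_chain int p).
Proof.
case=> _ H1 /(d1_closed int) /H1[mu dmu]; have [q qmu _] := int_chain_ochain mu.
by exists (size q), q; rewrite // -d2_ochain qmu.
Qed.

Lemma path_chain_cat p s :
  path_chain int (p ++ s) = path_chain int p + path_chain int s.
Proof. exact: ochain_cat. Qed.

(** Each application of [shortcut] costs one short closed path, made of the
    replaced subpath and of the inverse of its replacement, and decreases the
    length, so that at most [size p] of them occur. *)
Lemma filled_of_short M D d : is_distance (@ends Y) d -> four_point d D ->
  (forall u p, edge_path (@ends Y) u p u -> (size p <= 4 * D.+1)%N ->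
     filled M (path_chain int p)) ->
  forall u p, edge_path (@ends Y) u p u ->
    filled (size p * M) (path_chain int p).
Proof.
move=> dP d4 short u p; have [n] := ubnP (size p).
elim: n u p => // n IH u p pn pP.
have [pD|Dp] := leqP (size p) D.
  case: p pP pD {pn} => [|x p] pP pD.
    by rewrite /path_chain big_nil; apply: filled0.
  by apply: filled_leq (short _ _ pP _); rewrite ?leq_pmull //; lia.
have [a [s [b [pE [sD [s' s's [v [w [aP sP s'P bP]]]]]]]]] :=
  shortcut dP d4 pP Dp.
have p'P := edge_path_cat aP (edge_path_cat s'P bP).
have ssP := edge_path_cat sP (edge_path_inv s'P).
have -> : path_chain int p = path_chain int (a ++ s' ++ b) +
    path_chain int (s ++ path_inv s').
  rewrite pE !path_chain_cat path_chain_inv.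
  rewrite [path_chain _ s + _]addrC [path_chain _ s' + _]addrC !addrA.
  by rewrite [_ + path_chain _ s' + _]addrAC addrK.
apply: filled_leq (filledD (IH _ _ _ p'P) (short _ _ ssP _)).
- by rewrite -mulSnr leq_mul2r pE !size_cat; apply/orP; right; lia.
- by move: pn; rewrite pE !size_cat; lia.
- by rewrite size_cat /path_inv size_rev size_map; lia.
Qed.

(** A closed path that is not a circuit either meets a vertex twice, and splits
    there into two shorter closed paths, or runs through an edge in both
    directions; the two opposite passages then cancel as chains, and what
    remains splits into two shorter closed paths. *)
Lemma filled_of_circuits M N :
  (forall p, circuit (@ends Y) p -> (size p <= N)%N ->
     filled M (path_chain int p)) ->
  forall u p, edge_path (@ends Y) u p u -> (size p <= N)%N ->
    filled (size p * M) (path_chain int p).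
Proof.
move=> circ u p; have [n] := ubnP (size p).
elim: n u p => // n IH u p pn pP pN.
(* Induction step: a decomposition into shorter closed paths suffices. *)
have split a b u1 u2 : edge_path (@ends Y) u1 a u1 ->
    edge_path (@ends Y) u2 b u2 -> (size a < size p)%N ->
    (size b < size p)%N -> (size a + size b <= size p)%N ->
    path_chain int p = path_chain int a + path_chain int b ->
    filled (size p * M) (path_chain int p).
  move=> aP bP sa sb ab ->.
  apply: filled_leq (filledD (IH _ _ _ aP _) (IH _ _ _ bP _));
    rewrite -?mulnDl ?leq_mul2r ?ab ?orbT //; lia.
have repeat : ~~ uniq (map (osrc (@ends Y)) p) ->
    filled (size p * M) (path_chain int p).
  case/not_uniq_map=> a [x [b [y [c [pE xy]]]]].
  have := pP; rewrite {1}pE => /edge_path_split[w aP].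
  rewrite -cat_cons => /edge_path_split[v xbP ycP].
  have xw : osrc (@ends Y) x = w by case/andP: xbP => /eqP.
  have vw : v = w by case/andP: ycP => /eqP<- _; rewrite -xy.
  rewrite {v}vw in xbP ycP; apply: split (edge_path_cat aP ycP) xbP _ _ _ _;
    rewrite ?pE ?size_cat /= ?size_cat /=; [lia..|].
  by rewrite -cat_cons !path_chain_cat addrCA addrC.
have [->|p0] := eqVneq p [::].
  by rewrite /path_chain big_nil; apply: filled0.
have [pc|] := boolP (circuit (@ends Y) p).
  by apply: filled_leq (circ _ pc pN); rewrite leq_pmull // lt0n size_eq0.
rewrite /circuit !negb_and orbA; case/orP; first case/orP.
- by case/negP; apply/closed_pathP; split; [apply/eqP|exists u].
- exact: repeat.
case/not_uniq_map=> a [x [b [y [c [pE xy]]]]].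
have [oxy|oxy] := eqVneq (osrc (@ends Y) x) (osrc (@ends Y) y).
  apply: repeat; rewrite pE !(map_cat, cat_uniq, map_cons) /= oxy.
  by rewrite !mem_cat inE eqxx orbT /= !andbF.
have yE : y = orev x.
  by case: x y xy oxy {pE} => [e [|]] [e' [|]] /= -> //; rewrite eqxx.
have := pP; rewrite {1}pE => /edge_path_split[w aP /= /andP[/eqP xw]].
case/edge_path_split=> v bP /= /andP[/eqP yv cP].
have {}cP : edge_path (@ends Y) w c u by move: cP; rewrite yE /otgt orevK xw.
have {}bP : edge_path (@ends Y) (otgt (@ends Y) x) b (otgt (@ends Y) x).
  by move: bP; rewrite -yv yE.
apply: split (edge_path_cat aP cP) bP _ _ _ _;
  rewrite ?pE ?size_cat /= ?size_cat /=; [lia..|].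
rewrite -cat1s -[y :: c]cat1s !path_chain_cat.
have -> : path_chain int [:: y] = - path_chain int [:: x].
  by rewrite yE -path_chain_inv.
by rewrite [path_chain _ b + _]addrCA addNKr -addrA [path_chain _ c + _]addrC.
Qed.
End Fillings.

(** * Integral cycles are sums of closed paths *)

Section CyclesAreSumsOfClosedPaths.
Variables (Y : cell_complex) (M : nat).
Hypothesis closedM : forall u p, edge_path (@ends Y) u p u ->
  filled (size p * M) (path_chain int p).

Let bd (x : cell Y 1 * bool) : malg (cell Y 0) int :=
  << otgt (@ends Y) x >> - << osrc (@ends Y) x >>.

(** [p] is a path under construction and [r] lists the edges still to be used.
    Once [p] is closed it is filled and a new path starts from [r]. Otherwise
    the boundary condition forces an edge of [r] to start where [p] ends, and
    [p] is extended by that edge. *)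
Lemma walk_filled u v p r : edge_path (@ends Y) u p v ->
    \sum_(x <- r) bd x = << u >> - << v >> ->
  filled ((size p + size r) * M) (path_chain int (p ++ r)).
Proof.
have [n] := ubnP (size r); elim: n u v p r => // n IH u v p r rn pP rP.
have [uv|uv] := eqVneq u v.
  rewrite -{v}uv subrr in pP rP.
  rewrite path_chain_cat mulnDl; apply: filledD (closedM pP) _.
  case: r rn rP => [|x r] rn.
    by move=> _; rewrite /path_chain big_nil; apply: filled0.
  rewrite big_cons => /eqP; rewrite addrC addr_eq0 /bd opprB => /eqP rP.
  by apply: (IH _ _ [:: x]) rP => //=; rewrite !eqxx.
have /hasP[x xr /eqP xv] : has (fun x => osrc (@ends Y) x == v) r.
  apply/negPn/negP => /hasPn H.
  have : 0 <= (\sum_(x <- r) bd x)@_v.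
    rewrite raddf_sum big_seq; apply: sumr_ge0 => x /H xv.
    by rewrite /= mcoeffB !mcoeffU (negbTE xv) mulr0n subr0 mulrn_wge0.
  by rewrite rP mcoeffB !mcoeffU (negbTE uv) eqxx.
have rx := perm_to_rem xr.
have -> : path_chain int (p ++ r) = path_chain int ((p ++ [:: x]) ++ rem x r).
  by apply: ochain_perm; rewrite -catA perm_cat2l.
have -> : (size p + size r = size (p ++ [:: x]) + size (rem x r))%N.
  by rewrite (perm_size rx) size_cat /=; lia.
apply: (IH u (otgt (@ends Y) x)).
- by move: rn; rewrite (perm_size rx).
- by apply: edge_path_cat pP _; rewrite /= xv !eqxx.
move: rP; rewrite (perm_big _ rx) big_cons /bd xv => /(canRL (addKr _)) ->.
by rewrite opprB addrC addrA subrK.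
Qed.

Lemma cycle_filled (p : seq (cell Y 1 * bool)) : d1 (path_chain int p) = 0 ->
  filled (size p * M) (path_chain int p).
Proof.
case: p => [|x p]; first by rewrite /path_chain big_nil => _; apply: filled0.
rewrite d1_path_chain big_cons => /eqP; rewrite addrC addr_eq0 opprB => /eqP pP.
by apply: (walk_filled (p := [:: x])) pP => //=; rewrite !eqxx.
Qed.

End CyclesAreSumsOfClosedPaths.

(** * Uniform fillings of short circuits *)

Section Action.
Variables (G : groupType) (Y : cell_complex) (A : cell_action G Y).
Local Notation gmap g := (map (Defs.omap (act A g) (flip A g))).

Lemma act_inj n g : injective (@act G Y A n g).
Proof.
by apply: (can_inj (g := act A g^-1%g)) => c; rewrite -act_mul mulVg act_id.
Qed.

Lemma actKV n g : cancel (@act G Y A n g^-1%g) (act A g).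
Proof. by move=> c; rewrite -act_mul mulgV act_id. Qed.

(** The action of [g] on lists of oriented edges thus induces a map on
    chains. *)
Lemma path_chain_act g (p p' : seq (cell Y 1 * bool)) :
  path_chain int p = path_chain int p' ->
  path_chain int (gmap g p) = path_chain int (gmap g p').
Proof.
move=> pp'; apply/malgP => e; rewrite -(actKV g e); set e0 := act A _ e.
suff coefE s : (path_chain int (gmap g s))@_(act A g e0) =
    (-1) ^+ flip A g e0 * (path_chain int s)@_e0 by rewrite !coefE pp'.
rewrite !mcoeff_ochain big_map mulr_sumr; apply: eq_bigr => x _ /=.
rewrite (inj_eq (@act_inj _ _)); case: eqP => [->|_]; last by rewrite mulr0.
by rewrite !mulr1n signr_addb.
Qed.

Lemma filled_act g m (p : seq (cell Y 1 * bool)) :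
  filled m (path_chain int p) -> filled m (path_chain int (gmap g p)).
Proof.
case=> q qm /(path_chain_act g) <-; exists (gmap g q).
  by rewrite size_map.
apply: ochain_perm; elim: q {qm} => //= y q IH.
by rewrite map_cat perm_cat // obdry_act perm_rot.
Qed.

Lemma edge_path_act g u p v : edge_path (@ends Y) u p v ->
  edge_path (@ends Y) (act A g u) (gmap g p) (act A g v).
Proof.
elim: p u => [|x p IH] u /=; first by move/eqP->.
case/andP=> /eqP<- /IH; rewrite osrc_act eqxx /= /otgt -osrc_act.
by rewrite /orev /Defs.omap /= addbN.
Qed.

Lemma circuit_act g p : circuit (@ends Y) p -> circuit (@ends Y) (gmap g p).
Proof.
case/and3P=> /closed_pathP[p0 [u pP]] p1 p2; apply/and3P; split.
- apply/closed_pathP; split; first by case: p p0 {pP p1 p2}.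
  by exists (act A g u); apply: edge_path_act.
- rewrite -map_comp (eq_map (g := act A g \o osrc (@ends Y))) => [|x].
    by rewrite map_comp map_inj_uniq //; apply: act_inj.
  exact: osrc_act.
rewrite -map_comp (eq_map (g := act A g \o fst)) //.
by rewrite map_comp map_inj_uniq //; apply: act_inj.
Qed.

Lemma finite_bound (T : eqType) (S : set T) (P : nat -> T -> Prop) :
  finite_set S -> (forall m n x, (m <= n)%N -> P m x -> P n x) ->
  (forall x, S x -> exists m, P m x) -> exists m, forall x, S x -> P m x.
Proof.
case/finite_seqP=> s -> mono; elim: s => [|x s IH] exP; first by exists 0%N.
have [|m mP] := IH; first by move=> y ys; apply: exP; rewrite /= inE ys orbT.
have [n nP] := exP x (mem_head _ _); exists (m + n)%N => y /=.
rewrite inE => /predU1P[->|ys]; first by apply: mono nP; apply: leq_addl.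
by apply: mono (mP y ys); apply: leq_addr.
Qed.

(** It is enough to bound the fillings of the circuits through one edge of each
    orbit: any circuit is a translate of such a circuit. *)
Lemma circuits_uniformly_filled N :
  one_acyclic Y -> cocompact A -> fine_skeleton Y ->
  exists M, forall p, circuit (@ends Y) p -> (size p <= N)%N ->
    filled M (path_chain int p).
Proof.
move=> acyc cocp fine.
pose P M (O : set {n & cell Y n}) := forall p e, circuit (@ends Y) p ->
  (size p <= N)%N -> e \in map fst p ->
  orbit_cell A (Tagged (fun n => cell Y n) e) = O ->
  filled M (path_chain int p).
have orbit_act c c' : orbit_cell A c = orbit_cell A c' -> orbit_cell A c' c.
  by move=> <-; exists 1%g => //; case: c => n c; rewrite act_id.
have flip1 n (c : cell Y n.+1) : flip A 1%g c = false.
  by have := flip_mul A 1%g 1%g c; rewrite mulg1 act_id addbb.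
have [||M MP] := @finite_bound _ _ P cocp.
- by move=> m n O mn Om p e pc pN ep eO; apply: filled_leq mn _; apply: Om eO.
- move=> _ [[n e0] _ <-].
  (* Orbits of cells of other dimensions impose no condition. *)
  have [n1|n1] := eqVneq n 1%N; last first.
    exists 0%N => p e _ _ _ /orbit_act[g _ eE].
    by have /eqP := congr1 tag eE; rewrite /= (negbTE n1).
  rewrite {n}n1 in e0 *.
  have [||m mP] := @finite_bound _ _
    (fun m p => filled m (path_chain int p)) (fine e0 N.+1 isT).
  - by move=> m n p; apply: filled_leq.
  - move=> p [/and3P[/closed_pathP[_ [u pP]] _ _] _].
    exact: closed_path_filled pP.
  exists m => p e pc pN ep /orbit_act[g _ /eqP].
  rewrite eq_Tagged /= => /eqP ge0.
  have -> : p = gmap g (gmap g^-1%g p).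
    rewrite -map_comp -[LHS]map_id; apply: eq_map => -[c b].
    by rewrite /Defs.omap /= actKV addbA -flip_mul mulgV flip1.
  apply/filled_act/mP; split; first exact: circuit_act.
  split; first by rewrite size_map ltnW.
  have /mapP[x xp eE] := ep; apply/mapP.
  exists (Defs.omap (act A g^-1%g) (flip A g^-1%g) x); first exact: map_f.
  by rewrite /= -eE -ge0 -act_mul mulVg act_id.
exists M => p pc pN; case: p pc pN => [|x p] pc pN //.
apply: (MP _ _ (x :: p) x.1 pc pN (mem_head _ _) erefl).
by exists (Tagged (fun n => cell Y n) x.1).
Qed.

End Action.

(** * From Gromov products to the four-point inequality *)

Section Hyperbolicity.
Variables (R : realType) (Y : cell_complex) (d : cell Y 0 -> cell Y 0 -> nat).
Hypothesis dP : is_distance (@ends Y) d.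

Lemma route_vertices u v l : route (AtVertex R u) (AtVertex R v) l ->
  exists2 c, edge_path (@ends Y) u c v & l = (size c)%:R.
Proof.
suff H P Q : route P Q l -> P = AtVertex R u -> Q = AtVertex R v ->
    exists2 c, edge_path (@ends Y) u c v & l = (size c)%:R by move/H; apply.
case=> // {}P {}Q u' a c v' b up vq cP Pu Qv.
move: up vq; rewrite Pu Qv !inE => /eqP[uE aE] /eqP[vE bE].
by exists c; rewrite -?uE -?vE // aE bE add0r addr0.
Qed.

Lemma gdist_vertices u v :
  gdist (AtVertex R u) (AtVertex R v) = (d u v)%:R.
Proof.
have [[p pP pd] dmin] := dP u v.
have lb : lbound [set l | route (AtVertex R u) (AtVertex R v) l] (d u v)%:R.
  by move=> _ /route_vertices[c /dmin cd ->]; rewrite ler_nat.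
have duv : route (AtVertex R u) (AtVertex R v) (d u v)%:R.
  have := @RouteVia R Y (AtVertex R u) (AtVertex R v) u 0 p v 0.
  by rewrite pd add0r addr0 !inE; apply.
apply/eqP; rewrite eq_le; apply/andP; split.
  by apply: ge_inf => //; exists (d u v)%:R.
by apply: lb_le_inf => //; exists (d u v)%:R.
Qed.

Lemma hyperbolic_four_point :
  hyperbolic_skeleton R Y -> exists D, four_point d D.
Proof.
case=> delta H; exists (Num.bound `|2 * delta|) => x a b c.
have := H (AtVertex R x) (AtVertex R a) (AtVertex R b) (AtVertex R c).
rewrite /gromov_product !gdist_vertices => h.
have hD : 2 * delta <= (Num.bound `|2 * delta|)%:R.
  by apply/(le_trans (ler_norm _))/ltW/archi_boundP.
rewrite -(ler_nat R) natrD natrD natr_max !natrD.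
move: h; rewrite !(distance_sym dP _ x) lerBlDr ge_min => h.
rewrite -lerBlDr le_max.
by case/orP: h => h; apply/orP; [right|left]; lra.
Qed.

End Hyperbolicity.

(** * The homological Dehn functions *)

Section DehnFunctionBound.
Variables (R : realType) (Y : cell_complex) (M : nat).
Hypothesis cycleM : forall p : seq (cell Y 1 * bool),
  d1 (path_chain int p) = 0 -> filled (size p * M) (path_chain int p).

Lemma FV_le (K : nzRingType) (iota : {rmorphism K -> R}) k :
  (FV iota Y k <= (M%:R * k%:R)%:E)%E.
Proof.
apply: ge_ereal_sup => _ [c [c0 ck] <-].
have [p pc ps] := int_chain_ochain c.
have pk : (size p <= k)%N.
  rewrite -(ler_nat R) (le_trans _ ck) // ps natr_sum.
  by apply: ler_sum => x _; rewrite -intr_norm -abszE.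
have [|q qM qc] := cycleM (p := p).
  by rewrite /path_chain -/(ochain _ p) pc.
apply: ge_ereal_inf; exists (l1norm iota (ochain K q))%:E.
  exists (ochain K q) => // e.
  by rewrite d2_ochain mcoeff_ochain_int [ochain _ _]qc [path_chain _ _]pc.
rewrite lee_fin (le_trans (l1norm_ochain iota q)) // -natrM ler_nat mulnC.
by rewrite (leq_trans qM) // leq_mul2r pk orbT.
Qed.

End DehnFunctionBound.

Theorem theorem1p7 (R : realType) (G : groupType) (Y : cell_complex)
    (A : cell_action G Y) :
  one_acyclic Y ->
  cocompact A ->
  fine_skeleton Y ->
  hyperbolic_skeleton R Y ->
  finite_edge_stabilizers A ->
  exists C : R, 0 <= C /\
    (forall k : nat, (FV_Z R Y k <= (C * k%:R)%:E)%E) /\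
    (forall k : nat, (FV_Q R Y k <= (C * k%:R)%:E)%E).
Proof.
move=> acyc cocp fine hyp _.
have [d dP] := exists_distance acyc.1.
have [D d4] := hyperbolic_four_point dP hyp.
have [M circM] := circuits_uniformly_filled (4 * D.+1) acyc cocp fine.
pose N := (4 * D.+1)%N.
have shortM u p : edge_path (@ends Y) u p u -> (size p <= N)%N ->
    filled (N * M) (path_chain int p).
  move=> pP pN; apply: filled_leq (filled_of_circuits circM pP pN).
  by rewrite leq_mul2r pN orbT.
have cycleM := cycle_filled (filled_of_short dP d4 shortM).
exists (N * M)%:R; split; first exact: ler0n.
by split=> k; apply: FV_le.
Qed.
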